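(* Let $n$ be an even positive integer and let $k$ be a positive integer. If $F_{n-1}\equiv 1\pmod k$, then $k$ divides $(F_n-1)(F_{n+1}-1)$. Furthermore, the equation $$F_nx+F_{n+1}y=\frac{(F_n-1)(F_{n+1}-1)}{k}$$ has the unique nonnegative integral solution $$x=y=\frac{F_{n-1}-1}{k}.$$
   Context: $(F_n)$ is the Fibonacci sequence with $F_1=F_2=1$ and $F_n=F_{n-1}+F_{n-2}$ for all $n\in\mathbb{Z}$. *)

(* Defs.v *)
From HB Require Import structures.
From mathcomp Require Import all_boot all_order all_algebra.

Set Implicit Arguments.
Unset Strict Implicit.
Unset Printing Implicit Defensive.

Import Order.TTheory GRing.Theory Num.Theory.
Local Open Scope ring_scope.

Fixpoint fib_nat (n : nat) : int :=
  if n is n'.+1 then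
    if n' is n''.+1 then fib_nat n' + fib_nat n'' else 1
  else 0.

(* On negative indices F_(-m) = (-1)^(m+1) F_m; Negz m stands for -(m+1).
   The lemmas below characterize fib uniquely. *)
Definition fib (n : int) : int :=
  match n with
  | Posz m => fib_nat m
  | Negz m => (-1) ^+ m * fib_nat m.+1
  end.

Lemma fib1 : fib 1 = 1.
Proof. by []. Qed.

Lemma fib2 : fib 2 = 1.
Proof. by []. Qed.

Lemma fib_rec (n : int) : fib n = fib (n - 1) + fib (n - 2).
Proof.
case: n => [[|[|m]]|m] //.
- have -> : Posz m.+2 - 1 = Posz m.+1 by rewrite -addn1 PoszD addrK.
  by have -> : Posz m.+2 - 2 = Posz m by rewrite -addn2 PoszD addrK.
have -> : Negz m - 1 = Negz m.+1 by rewrite !NegzE -opprD -PoszD addn1.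
have -> : Negz m - 2 = Negz m.+2 by rewrite !NegzE -opprD -PoszD addn2.
have fibN j : fib (Negz j) = (-1) ^+ j * fib_nat j.+1 by [].
have fibSS j : fib_nat j.+2 = fib_nat j.+1 + fib_nat j by [].
rewrite !fibN (fibSS m.+1) !exprS.
move: (fib_nat m.+1) (fib_nat m.+2) => a b.
by rewrite !mulN1r opprK mulrDr mulNr addKr.
Qed.

(* Main.v *)
Require Import Defs.
From mathcomp Require Import all_boot all_order all_algebra.
From mathcomp Require Import ring zify.

Import Order.TTheory GRing.Theory Num.Theory.
Local Open Scope ring_scope.

(** Write [a], [b], [c = a + b] for the Fibonacci numbers of index [n - 1],
    [n], [n + 1].  As [n] is even, Cassini's identity reads [c * a - b * b = 1]
    ([cassini]), and this gives [(b - 1) * (c - 1) = (a - 1) * (b + c)].  So if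
    [a - 1 = t * k], then [k] divides the left-hand side and the equation
    becomes [b * x + c * y = (b + c) * t], of which [x = y = t] is a solution.
    Cassini's identity is also a Bezout relation for [b] and [c], so the
    integral solutions are [x = t + c * s], [y = t - b * s].  Since
    [t <= a - 1 < b <= c], nonnegativity of [x] and [y] forces [s = 0]
    ([nonneg_solution_unique]). *)

Lemma fib_natSS (m : nat) : fib_nat m.+2 = fib_nat m.+1 + fib_nat m.
Proof. by []. Qed.

Lemma fib_nat_gt0 (m : nat) : 0 < fib_nat m.+1.
Proof.
suff: (0 < fib_nat m.+1) && (0 <= fib_nat m) by case/andP.
by elim: m => // m /andP[F1 F0]; rewrite fib_natSS; lia.
Qed.

Lemma fib_nat_ge0 (m : nat) : 0 <= fib_nat m.
Proof. by case: m => // m; exact/ltW/fib_nat_gt0. Qed.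

Lemma cassini (m : nat) :
  fib_nat m.+2 * fib_nat m - fib_nat m.+1 * fib_nat m.+1 = (-1) ^+ m.+1.
Proof.
elim: m => // m IHm; rewrite exprS -IHm !fib_natSS.
by move: (fib_nat m) (fib_nat m.+1) => a b; ring.
Qed.

(** The bounds [t < b] and [t < c] say that moving from [(t, t)] by a nonzero
    multiple of [(c, - b)] makes one coordinate negative. *)
Lemma nonneg_solution_unique (a b c t x y : int) :
    c * a - b * b = 1 -> 0 <= t -> t < b -> t < c -> 0 <= x -> 0 <= y ->
  b * x + c * y = (b + c) * t -> x = t /\ y = t.
Proof.
move=> bezout t0 tb tc x0 y0 eqn.
(* The parameter of the solution line: since [b * (x - t) = c * (t - y)],
   multiplying by [c * a - b * b = 1] gives [x - t = c * s], [t - y = b * s]. *)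
pose s := a * (x - t) - b * (t - y).
have eq0 : b * x + c * y - (b + c) * t = 0 by rewrite eqn subrr.
have bez0 : c * a - b * b - 1 = 0 by rewrite bezout subrr.
have xE : x = t + c * s.
  apply/eqP; rewrite -subr_eq0; apply/eqP.
  transitivity (- (c * a - b * b - 1) * (x - t)
                - b * (b * x + c * y - (b + c) * t)).
    by rewrite /s; ring.
  by rewrite eq0 bez0; ring.
have yE : y = t - b * s.
  apply/eqP; rewrite -subr_eq0; apply/eqP.
  transitivity ((c * a - b * b - 1) * (t - y)
                + a * (b * x + c * y - (b + c) * t)).
    by rewrite /s; ring.
  by rewrite eq0 bez0; ring.
suff s0 : s = 0 by rewrite xE yE s0; split; ring.
have [s_gt0|s_lt0|//] := ltrgt0P s.
  have : 0 <= b * (s - 1) by apply: mulr_ge0; lia.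
  by rewrite mulrBr mulr1; lia.
have : c * (s + 1) <= 0 by apply: mulr_ge0_le0; lia.
by rewrite mulrDr mulr1; lia.
Qed.

Theorem proposition3p1 (n k : int) (n_gt0 : 0 < n) (n_even : (2 %| n)%Z)
    (k_gt0 : 0 < k) (Fk : (fib (n - 1) = 1 %[mod k])%Z) :
  (k %| (fib n - 1) * (fib (n + 1) - 1))%Z /\
  (forall x y : int,
     [/\ 0 <= x, 0 <= y &
         fib n * x + fib (n + 1) * y
           = (((fib n - 1) * (fib (n + 1) - 1)) %/ k)%Z] <->
     x = ((fib (n - 1) - 1) %/ k)%Z /\ y = ((fib (n - 1) - 1) %/ k)%Z).
Proof.
have [m nE] : exists m : nat, n = Posz m.*2.+2.
  by exists (`|n| %/ 2).-1%N; move: n_gt0 n_even; clear; lia.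
have fibB : fib (n - 1) = fib_nat m.*2.+1.
  by rewrite (_ : n - 1 = Posz m.*2.+1) //; lia.
have fibD : fib (n + 1) = fib_nat m.*2.+3.
  by rewrite (_ : n + 1 = Posz m.*2.+3) //; lia.
have fibn : fib n = fib_nat m.*2.+2 by rewrite nE.
rewrite fibB in Fk *; rewrite fibD fibn; clear fibB fibD fibn.
have := cassini m.*2.+1; rewrite -signr_odd !oddS odd_double expr0.
have := fib_nat_gt0 m.*2; have := fib_nat_ge0 m.*2.
have := fib_natSS m.*2; have := fib_natSS m.*2.+1.
move: Fk; move: (fib_nat m.*2) (fib_nat m.*2.+1) (fib_nat m.*2.+2)
  (fib_nat m.*2.+3) => d a b c Fk cE bE d0 a0 cas.
have kNZ : k != 0 by rewrite gt_eqF.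
have /dvdzP[t tE] : (k %| a - 1)%Z by rewrite -eqz_mod_dvd; apply/eqP.
have prodE : (b - 1) * (c - 1) = (b + c) * t * k.
  rewrite -mulrA -tE.
  transitivity ((a - 1) * (b + c) - (c * a - b * b - 1)); last first.
    by rewrite cas; ring.
  by rewrite cE; ring.
have t0 : 0 <= t by rewrite -(pmulr_lge0 _ k_gt0) -tE; lia.
have ta : t <= a - 1 by rewrite tE ler_peMr //; lia.
split; first by rewrite prodE dvdz_mull.
rewrite prodE tE !mulzK // => x y; split.
  case=> x0 y0; apply: nonneg_solution_unique cas _ _ _ x0 y0; lia.
by case=> -> ->; split=> //; rewrite mulrDl.
Qed.
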